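(* A set $E\subseteq\mathbb{R}$ is $\operatorname{Lip}1$ if and only if there is a ternary decomposition of $\mathbb{R}$ with respect to $E$.
   Context: For a continuous $f:\mathbb{R}\to\mathbb{R}$, $x\in\mathbb{R}$ and $r>0$ put $M_f(x,r)=\frac{1}{r}\sup\{|f(x)-f(y)|:|x-y|\le r\}$ and $\operatorname{Lip} f(x)=\limsup_{r\to0^+}M_f(x,r)$. A set $E\subseteq\mathbb{R}$ is $\operatorname{Lip}1$ if there is a continuous $f:\mathbb{R}\to\mathbb{R}$ with $\operatorname{Lip} f=\mathbf{1}_E$ (the characteristic function of $E$). $|A|$ denotes the Lebesgue measure of $A$. For a sequence of non-degenerate closed intervals $\{I_n\}$, write $I_n\to x$ if $x\in I_n$ for all $n\in\mathbb{N}$ and $|I_n|\to0$. A measurable set $S$ is weakly dense at $x$ (where $x$ need not belong to $S$) if there exists $I_n\to x$ with $\frac{|S\cap I_n|}{|I_n|}\to1$. Let $E$ be a measurable subset of $\mathbb{R}$ and let $E_1,E_0,E_{-1}$ be pairwise disjoint measurable sets whose union is $\mathbb{R}$. Then $E_1,E_0,E_{-1}$ is a ternary decomposition of $\mathbb{R}$ with respect to $E$ if: (1) for every $x\in E$, either $E_1$ or $E_{-1}$ is weakly dense at $x$; and (2) for every $x\notin E$ and every sequence $I_n\to x$ we have $\frac{\big||E_1\cap I_n|-|E_{-1}\cap I_n|\big|}{|I_n|}\to0$. (In particular, having a ternary decomposition with respect to $E$ includes the measurability of $E$.) *)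

(* Defs.v *)
From mathcomp Require Import all_boot all_order all_algebra.
From mathcomp Require Import all_classical all_reals all_analysis.

Set Implicit Arguments.
Unset Strict Implicit.
Unset Printing Implicit Defensive.

Import Order.TTheory GRing.Theory Num.Theory.
Import numFieldNormedType.Exports.

Local Open Scope classical_set_scope.
Local Open Scope ring_scope.

(* The supremum is taken in \bar R, so that it needs no boundedness side
   condition; it is finite whenever f is continuous. *)
Definition M_ (R : realType) (f : R -> R) (x r : R) : \bar R :=
  ((r^-1)%:E *
   ereal_sup [set (`|f x - f y|)%:E | y in [set y | (`|x - y| <= r)%R]])%E.

Definition Lip (R : realType) (f : R -> R) (x : R) : \bar R :=
  limf_esup (M_ f x) 0^'+.

Definition Lip1 (R : realType) (E : set R) : Prop :=
  exists f : R -> R, continuous f /\ forall x, Lip f x = (\1_E x)%:E.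

(* Lebesgue (not merely Borel) measurability: the domain of
   completed_lebesgue_measure. The notation .-cara.-measurable is avoided
   because at type set R it can elaborate to the Borel instance. *)
Definition lebesgue_measurable (R : realType) (A : set R) : Prop :=
  caratheodory_measurable (wlength idfun)^*%mu A.

(* The measure as a real number; below, it is only taken of bounded sets. *)
Definition meas (R : realType) (A : set R) : R :=
  fine (@completed_lebesgue_measure R A).

Definition nondegenerate_closed_interval (R : realType) (I : set R) : Prop :=
  exists a b : R, a < b /\ I = `[a, b]%classic.

Definition shrinks_to (R : realType) (I : nat -> set R) (x : R) : Prop :=
  [/\ forall n, nondegenerate_closed_interval (I n),
      forall n, I n x
    & meas (I n) @[n --> \oo] --> (0 : R)].

Definition weakly_dense_at (R : realType) (S : set R) (x : R) : Prop :=
  exists I : nat -> set R, shrinks_to I x /\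
    meas (S `&` I n) / meas (I n) @[n --> \oo] --> (1 : R).

(* En1 stands for E_{-1}. *)
Record ternary_decomposition (R : realType) (E E1 E0 En1 : set R) : Prop :=
  TernaryDecomposition {
    ternary_measurable : lebesgue_measurable E;
    ternary_measurable1 : lebesgue_measurable E1;
    ternary_measurable0 : lebesgue_measurable E0;
    ternary_measurableN1 : lebesgue_measurable En1;
    ternary_disjoint10 : E1 `&` E0 = set0;
    ternary_disjoint1N1 : E1 `&` En1 = set0;
    ternary_disjoint0N1 : E0 `&` En1 = set0;
    ternary_cover : E1 `|` E0 `|` En1 = setT;
    ternary_in : forall x, E x -> weakly_dense_at E1 x \/ weakly_dense_at En1 x;
    ternary_notin : forall x, ~ E x ->
      forall I : nat -> set R, shrinks_to I x ->
        `|meas (E1 `&` I n) - meas (En1 `&` I n)| / meas (I n) @[n --> \oo]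
          --> (0 : R)
  }.

(* Main.v *)
(** For [f] with [Lip f = 1_E], [f] is 1-Lipschitz, so [g = (id + f) / 2] and
    [id - g] are both nondecreasing and their Stieltjes measures add up to
    Lebesgue measure. Radon-Nikodym and Lebesgue differentiation then give
    [f' in {-1, 0, 1}] a.e., whence with [E1 = {f' = 1}] and [En1 = {f' = -1}]
    every increment is [f b - f a = |E1 /\ [a, b]| - |En1 /\ [a, b]|].
    Conversely, a ternary decomposition defines such an [f] by this formula.
    Given the formula, [Lip f x >= 1] means that [E1] or [En1] is weakly dense
    at [x], and [Lip f x <= 0] is condition (2) of the definition, because an
    interval containing [x] splits into two intervals with endpoint [x]. *)

From HB Require Import structures.
Require Import Defs.
From mathcomp Require Import all_boot all_order all_algebra.
From mathcomp Require Import all_classical all_reals all_analysis.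
From mathcomp Require Import measurable_realfun ring lra.

Set Implicit Arguments.
Unset Strict Implicit.
Unset Printing Implicit Defensive.

Import Order.TTheory GRing.Theory Num.Theory.
Import numFieldNormedType.Exports.

Local Open Scope classical_set_scope.
Local Open Scope ring_scope.

(** * The pointwise Lipschitz constant: epsilon-delta forms, derivatives, and the global bound *)

Section Lip.
Context {R : realType}.
Implicit Types (f : R -> R) (x L : R).

Lemma M_leP f x r L : 0 < r ->
  (M_ f x r <= L%:E)%E <-> forall y, `|x - y| <= r -> `|f x - f y| <= L * r.
Proof.
move=> r0; rewrite /M_ lee_pdivrMl// -EFinM mulrC; split.
  move=> h y xy; rewrite -lee_fin; apply: le_trans h.
  by apply: ereal_sup_ubound; exists y.
by move=> h; apply: ge_ereal_sup => _ [y /= xy <-]; rewrite lee_fin; exact: h.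
Qed.

Lemma M_lt_ex f x r L : 0 < r -> (L%:E < M_ f x r)%E ->
  exists2 y, `|x - y| <= r & L * r < `|f x - f y|.
Proof.
move=> r0; rewrite ltNge => /negP h; apply: contrapT => H; apply: h.
apply/(M_leP _ _ _ r0) => y xy; rewrite leNgt.
by apply/negP => ?; apply: H; exists y.
Qed.

Lemma le_M f x y : y != x ->
  ((`|f y - f x| / `|y - x|)%:E <= M_ f x `|y - x|%R)%E.
Proof.
move=> yx; have r0 : 0 < `|y - x| by rewrite normr_gt0 subr_eq0.
rewrite /M_ muleC lee_pdivlMr// -EFinM divfK ?gt_eqF//.
by apply: ereal_sup_ubound; exists y => /=; rewrite distrC.
Qed.

(** The supremum over a ball reduces to slopes at single points: each [y] is a competitor at the
    radius [|y - x|], and conversely a bound proportional to [|y - x|] is at most the same multiple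
    of any larger radius. *)
Lemma Lip_leP f x L :
  (Lip f x <= L%:E)%E <->
  forall e, 0 < e -> exists2 d, 0 < d &
    forall y, `|y - x| < d -> `|f y - f x| <= (L + e) * `|y - x|.
Proof.
split=> [h e e0|h].
  have : (Lip f x < (L + e)%:E)%E by rewrite (le_lt_trans h)// lte_fin ltrDl.
  move=> /ereal_inf_lt[_ [V V0 <-]] hV.
  have [d /= d0 hd] := V0; exists d => // y yx.
  have [->|xy] := eqVneq y x; first by rewrite !subrr normr0 mulr0.
  have yx0 : 0 < `|y - x| by rewrite normr_gt0 subr_eq0.
  rewrite -ler_pdivrMr// -lee_fin (le_trans (le_M f xy))// ltW//.
  apply: le_lt_trans hV; apply: ereal_sup_ubound; exists `|y - x| => //.
  by apply: hd => //=; rewrite sub0r normrN normr_id.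
apply/lee_addgt0Pr => e e0; have [d d0 hd] := h e e0.
apply: (@le_trans _ _ (ereal_sup (M_ f x @` [set r | 0 < r < d]))).
  apply: ereal_inf_lbound; exists [set r | 0 < r < d] => //.
  by near=> r; apply/andP; split; near: r;
    [exact: nbhs_right_gt|exact: nbhs_right_lt].
apply: ge_ereal_sup => _ [r /= /andP[r0 rd] <-].
apply/M_leP => // y; rewrite (distrC x) (distrC (f x)) => yr.
(* [L] may be negative, but the bound at the single point [x + d / 2] forces [L + e >= 0], which
   allows [|y - x|] to be enlarged to [r]. *)
have Le : 0 <= L + e.
  have := hd (x + d / 2); rewrite addrAC subrr add0r gtr0_norm ?divr_gt0//.
  by move=> /(_ _)/(le_trans (normr_ge0 _)); rewrite pmulr_lge0 ?divr_gt0//; apply; lra.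
by apply: (le_trans (hd _ _)); [lra|exact: ler_wpM2l].
Unshelve. all: by end_near. Qed.

(** One [e] bounds both the distance and the loss of slope. Shrinking it tightens both, so in the
    converse [min d e] serves a given neighbourhood and a given error together. *)
Lemma Lip_geP f x L :
  (L%:E <= Lip f x)%E <->
  forall e, 0 < e -> exists y,
    [/\ y != x, `|y - x| < e & (L - e) * `|y - x| <= `|f y - f x|].
Proof.
split=> [h e e0|h].
  (* If [L <= e], the lower bound is nonpositive and any nearby point will do. Otherwise it is
     positive, and the point taken from the supremum cannot be [x] itself. *)
  have [Le|Le] := leP L e.
    exists (x + e / 2); rewrite addrAC subrr add0r gtr0_norm ?divr_gt0//.
    split; [by rewrite gt_eqF// ltrDl divr_gt0|lra|].
    by apply: (le_trans _ (normr_ge0 _)); rewrite mulr_le0_ge0//; lra.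
  have : (L%:E <= ereal_sup (M_ f x @` [set r | (0 < r < e)%R]))%E.
    apply: (le_trans h); apply: ereal_inf_lbound; exists [set r | 0 < r < e] => //.
    by near=> r; apply/andP; split; near: r;
      [exact: nbhs_right_gt|exact: nbhs_right_lt].
  have Lee : ((L - e)%:E < L%:E)%E by rewrite lte_fin; lra.
  move=> /(lt_le_trans Lee) /ereal_sup_gt[_ [r /= /andP[r0 re] <-]].
  move=> /(M_lt_ex r0)[y]; rewrite (distrC x) (distrC (f x)) => yr Lr.
  exists y; split; [|lra|].
    apply/eqP => yx; move: Lr; rewrite yx subrr normr0 ltNge mulr_ge0//; lra.
  by apply: le_trans (ltW Lr); apply: ler_wpM2l => //; lra.
apply: le_ereal_inf_tmp => _ [V [d /= d0 hd] <-].
apply/lee_subgt0Pr => e e0.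
have de0 : 0 < Order.min d e by rewrite lt_min d0.
have [y [yx]] := h _ de0; rewrite lt_min => /andP[yd ye] hy.
have yx0 : 0 < `|y - x| by rewrite normr_gt0 subr_eq0.
apply: (@le_trans _ _ (M_ f x `|y - x|)); last first.
  apply: ereal_sup_ubound; exists `|y - x| => //; apply: hd => //=.
  by rewrite sub0r normrN normr_id.
apply: le_trans (le_M f yx); rewrite lee_fin ler_pdivlMr//.
apply: le_trans hy; rewrite ler_wpM2r// lerD2l lerN2 ge_min lexx orbT//.
Unshelve. all: by end_near. Qed.

Lemma Lip_ge0 f x : (0 <= Lip f x)%E.
Proof.
apply/Lip_geP => e e0; exists (x + e / 2).
rewrite addrAC subrr add0r gtr0_norm ?divr_gt0//.
split; [by rewrite gt_eqF// ltrDl divr_gt0|lra|].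
by apply: (le_trans _ (normr_ge0 _)); rewrite mulr_le0_ge0//; lra.
Qed.

Lemma is_derive_slope f x df e : is_derive x 1 f df -> 0 < e ->
  exists2 d, 0 < d & forall y, y != x -> `|y - x| < d ->
    `|df - (f y - f x) / (y - x)| <= e.
Proof.
move=> dfx.
have : h^-1 *: (f (h *: 1 + x) - f x) @[h --> 0^'] --> df.
  by rewrite -[in X in _ --> X](@derive_val _ _ _ _ _ _ _ dfx); exact: ex_derive.
move=> /cvgrPdist_le H /H[d /= d0 hd]; exists d => // y yx yxd.
have := hd (y - x); rewrite /= sub0r normrN subr_eq0 => /(_ yxd yx).
by rewrite -[_ *: 1]/((y - x) * 1) mulr1 subrK mulrC.
Qed.

(** By the reverse triangle inequality, slopes close to [df] have absolute values close to [|df|].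
    This is what forces [f'] into {-1, 0, 1} wherever it exists. *)
Lemma is_derive_Lip f x df : is_derive x 1 f df -> Lip f x = `|df|%:E.
Proof.
move=> dfx; have slope := is_derive_slope dfx.
apply/eqP; rewrite eq_le; apply/andP; split.
  apply/Lip_leP => e /slope[d d0 hd]; exists d => // y yxd.
  have [->|yx] := eqVneq y x; first by rewrite !subrr normr0 mulr0.
  have yx0 : 0 < `|y - x| by rewrite normr_gt0 subr_eq0.
  rewrite -ler_pdivrMr// -normf_div -lerBlDl.
  by apply: le_trans (hd _ yx yxd); rewrite distrC; exact: lerB_dist.
apply/Lip_geP => e e0; have [d d0 hd] := slope _ e0.
have m0 : 0 < Order.min d e by rewrite lt_min d0.
have md : Order.min d e <= d by rewrite ge_min lexx.
have me : Order.min d e <= e by rewrite ge_min lexx orbT.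
pose y := x + Order.min d e / 2.
have yxE : `|y - x| = Order.min d e / 2.
  by rewrite /y addrAC subrr add0r gtr0_norm// divr_gt0.
have yx0 : 0 < `|y - x| by rewrite yxE divr_gt0.
have yx : y != x by rewrite -subr_eq0 -normr_gt0.
exists y; split=> //; first by lra.
rewrite -ler_pdivlMr// -normf_div lerBlDl -lerBlDr.
by apply: (le_trans (lerB_dist _ _)); apply: hd => //; lra.
Qed.

(* The set of points [t] up to which the slope from [a] is at most [1 + e] has a
   largest element, which the hypothesis forces to be [b]. *)
Lemma Lip_le1_lipschitz f : continuous f -> (forall x, (Lip f x <= 1)%E) ->
  forall x y, `|f x - f y| <= `|x - y|.
Proof.
move=> cf f1.
suff H a b : a < b -> `|f b - f a| <= b - a.
  move=> x y; have [xy|yx|->] := ltgtP x y.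
  - by rewrite distrC (distrC x) [leRHS]gtr0_norm ?subr_gt0//; exact: H.
  - by rewrite [leRHS]gtr0_norm ?subr_gt0//; exact: H.
  - by rewrite !subrr.
move=> ab; apply/ler_addgt0Pr => e' e'0.
pose e := e' / (b - a).
have e0 : 0 < e by rewrite divr_gt0 ?subr_gt0.
have -> : b - a + e' = (1 + e) * (b - a).
  by rewrite mulrDl mul1r divfK// gt_eqF ?subr_gt0.
pose S := [set t | a <= t <= b /\ `|f t - f a| <= (1 + e) * (t - a)].
have Sa : S a by split; [lra|rewrite !subrr normr0 mulr0].
have hS : has_sup S by split; [exists a|exists b => t [/andP[]]].
have cab : a <= sup S <= b.
  by rewrite ub_le_sup//=; [rewrite ge_sup//; [exists a|move=> t [/andP[]]]|exact: hS.2].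
set c := sup S in cab.
(* The supremum is attained: otherwise the excess [u] would be positive on a neighbourhood of [c],
   which contains points of [S]. *)
have Sc : `|f c - f a| <= (1 + e) * (c - a).
  rewrite leNgt; apply/negP => abs.
  pose u t := `|f t - f a| - (1 + e) * (t - a).
  have cu : {for c, continuous u}.
    apply: cvgB; first by apply: cvg_norm; apply: cvgB; [exact: cf|exact: cvg_cst].
    by apply: cvgMl_tmp; apply: cvgB => //; exact: cvg_cst.
  have uc : 0 < u c by rewrite subr_gt0.
  have [d /= d0 hd] : \forall t \near c, 0 < u t by exact: (cvgr_gt _ cu).
  have [t St ct] := sup_adherent d0 hS.
  have tc : t <= c by apply: ub_le_sup => //; exact: hS.2.
  have /= : 0 < u t.
    by apply: hd; rewrite /ball/= ger0_norm ?subr_ge0//; rewrite -/c in ct; lra.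
  by rewrite subr_gt0 ltNge St.2.
have [<-//|cb] := eqVneq c b.
have {}cb : c < b by rewrite lt_neqAle cb; case/andP: cab.
have [d d0 hd] := (Lip_leP f c 1).1 (f1 c) e e0.
(* Half the radius keeps [t] strictly within reach of the slope bound at [c], and the cut at [b - c]
   keeps it in the interval. Then [t] is in [S] beyond its supremum. *)
pose t := c + Order.min (d / 2) (b - c).
have m0 : 0 < Order.min (d / 2) (b - c) by rewrite lt_min divr_gt0//= subr_gt0.
have mb : Order.min (d / 2) (b - c) <= b - c by rewrite ge_min lexx orbT.
have md : Order.min (d / 2) (b - c) <= d / 2 by rewrite ge_min lexx.
have tc : t - c = Order.min (d / 2) (b - c) by rewrite /t addrAC subrr add0r.
have ftc := hd t; rewrite tc gtr0_norm// in ftc.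
have {}ftc := ftc ltac:(lra).
have St : S t.
  split; first by rewrite /t; lra.
  apply: (le_trans (ler_distD (f c) _ _)); apply: (le_trans (lerD ftc Sc)).
  by rewrite -tc -mulrDr; apply: ler_wpM2l; lra.
have : t <= c by apply: ub_le_sup => //; exact: hS.2.
by rewrite /t; lra.
Qed.

End Lip.

(** * Differentiation almost everywhere, and increments as differences of measures *)

Section density.
Context {R : realType}.
Implicit Types (f g : R -> R) (x : R).
Local Notation lambda := (@lebesgue_measure R).

Lemma lebesgue_stieltjes_measure_ocitv (g : cumulative R R) (a b : R) :
  a <= b -> lebesgue_stieltjes_measure g `]a, b]%classic = (g b - g a)%:E.
Proof.
move=> ab; rewrite /lebesgue_stieltjes_measure/= /measure_extension.
by rewrite measurable_mu_extE/= ?wlength_itv_bnd//; exact: is_ocitv.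
Qed.

Lemma lipschitz_continuous f :
  (forall x y, `|f x - f y| <= `|x - y|) -> continuous f.
Proof.
move=> lf x; apply/cvgrPdist_le => e e0.
by exists e => //= y /ltW; exact: (le_trans (lf _ _)).
Qed.

(** The Stieltjes measures of [g] and of [x - g x] add up to Lebesgue measure on half-open
    intervals, hence on all Borel sets. So the former is absolutely continuous, and [h] is its
    Radon-Nikodym derivative. *)
Lemma monotone_density g a b : a < b -> nondecreasing g ->
    nondecreasing (fun x => x - g x) ->
  exists h : R -> R, lambda.-integrable setT (EFin \o h) /\
    forall c d, a <= c -> c <= d -> d <= b ->
      \int[lambda]_(t in `]c, d]) h t = g d - g c.
Proof.
move=> ab ndg ndg'.
(* Monotonicity of both functions squeezes each increment between 0 and that of the identity; this
   yields the right continuity that a Stieltjes measure requires. *)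
have lg x y : `|g x - g y| <= `|x - y|.
  wlog xy : x y / x <= y.
    by move=> H; have [/H//|/ltW/H] := leP x y; rewrite distrC (distrC x).
  rewrite ler0_norm ?subr_le0 ?ndg// ler0_norm ?subr_le0//.
  by have := ndg' _ _ xy; lra.
have lg' x y : `|(x - g x) - (y - g y)| <= `|x - y|.
  wlog xy : x y / x <= y.
    by move=> H; have [/H//|/ltW/H] := leP x y; rewrite distrC (distrC x).
  rewrite ler0_norm ?subr_le0 ?ndg'// ler0_norm ?subr_le0//.
  by have := ndg _ _ xy; lra.
pose G : cumulative R R := HB.pack g (isCumulative.Build R _ R g ndg
  (right_continuousW (lipschitz_continuous lg))).
pose G' : cumulative R R := HB.pack (fun x => x - g x)
  (isCumulative.Build R _ R (fun x => x - g x) ndg'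
  (right_continuousW (lipschitz_continuous lg'))).
pose muG : {measure set (measurableTypeR R) -> \bar R} :=
  lebesgue_stieltjes_measure G.
pose muG' : {measure set (measurableTypeR R) -> \bar R} :=
  lebesgue_stieltjes_measure G'.
have lambdaE A : measurable A -> lambda A = (muG A + muG' A)%E.
  move=> mA.
  rewrite -(measure_addE muG muG').
  apply: (@lebesgue_measure_unique _ (measure_add muG muG')) => //.
  move=> _ [[c d] _ <-]; rewrite [RHS]measure_addE.
  have [cd|cd] := leP c d; last first.
    by rewrite set_itv_ge ?measure0 ?adde0// bnd_simp -leNgt ltW.
  transitivity ((g d - g c)%:E + ((d - g d) - (c - g c))%:E)%E.
    rewrite -EFinD; transitivity ((d - c)%:E); last by congr (_%:E); ring.
    exact: (lebesgue_stieltjes_measure_ocitv idfun cd).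
  by congr (_ + _)%E; apply/esym;
    [exact: (lebesgue_stieltjes_measure_ocitv G cd)
    |exact: (lebesgue_stieltjes_measure_ocitv G' cd)].
have mab : measurable (`]a, b]%classic : set (measurableTypeR R)).
  exact: measurable_itv.
have abfin : (muG `]a, b]%classic < +oo)%E.
  by rewrite (_ : muG _ = (g b - g a)%:E) ?ltry//;
    exact: (lebesgue_stieltjes_measure_ocitv G (ltW ab)).
(* Restricting to []a, b]] makes the measure finite, hence its density integrable over the whole
   line. *)
pose nu := mfrestr mab abfin.
have nu_lambda : nu `<< lambda.
  apply/null_content_dominatesP => A mA A0.
  have nuA : (nu A <= muG A + muG' A)%E.
    by apply: (@le_trans _ _ (muG A));
      [exact: (measureIl muG mA mab)|exact: leeDl].
  apply/eqP; rewrite eq_le measure_ge0 andbT (le_trans nuA)//.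
  by rewrite -lambdaE//; move: A0 => /= ->.
have [h [h0 hfin ih hE]] := radon_nikodym_sigma_finite nu_lambda.
have hfineE : EFin \o (fine \o h) = h by apply/funext => x /=; rewrite fineK.
exists (fine \o h); split; first by rewrite hfineE.
move=> c d ac cd db; rewrite /Rintegral.
under eq_integral do rewrite /= fineK//.
rewrite -hE//= /nu /mfrestr /mrestr setIidl; last first.
  by move=> x /=; rewrite !in_itv/= => /andP[]; lra.
by rewrite (_ : muG _ = (g d - g c)%:E)//;
  exact: (lebesgue_stieltjes_measure_ocitv G cd).
Qed.

(** Almost every point is a Lebesgue point of [h], where the integral of [h] from [a] has derivative
    [h x]. Near a point strictly inside the interval, [g] differs from this integral by the constant
    [g a]. *)
Lemma monotone_ae_derive g a b : a < b -> nondecreasing g ->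
    nondecreasing (fun x => x - g x) ->
  exists h : R -> R, [/\ lambda.-integrable setT (EFin \o h),
    forall c d, a <= c -> c <= d -> d <= b ->
      \int[lambda]_(t in `]c, d]) h t = g d - g c &
    {ae lambda, forall x, a < x < b -> is_derive x 1 g (h x)}].
Proof.
move=> ab ndg ndg'; have [h [ih hE]] := monotone_density ab ndg ndg'.
exists h; split=> //.
have mh : measurable_fun setT h by case/integrableP : ih => /measurable_EFinP.
have loch : locally_integrable setT h.
  split; [exact: mh|exact: openT|].
  move=> K _ cK; apply: (@le_lt_trans _ _ (\int[lambda]_x `|h x|%:E)%E).
    apply: ge0_subset_integral => //; first exact: compact_measurable.
    exact/measurable_EFinP/measurableT_comp.
  by case/integrableP : ih.
have := lebesgue_differentiation loch.
apply: filterS; first exact: (ae_filter_ringOfSetsType lambda).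
move=> x hx /andP[ax xb].
pose F y := \int[lambda]_(t in `]a, y]) h t.
have ihab : lambda.-integrable `]a, b] (EFin \o h).
  by apply: integrableS ih => //; exact: measurable_itv.
have [dF dFE] := FTC1_lebesgue_pt xb ihab (ax : (BRight a < BRight x)%E) hx.
have dFx : is_derive x 1 F (h x).
  by rewrite -dFE derive1E; exact: derivableP.
have gE : \forall y \near x, F y + g a = g y.
  near=> y; rewrite /F hE ?subrK//; apply/ltW; near: y.
    exact: lt_nbhsr.
  exact: lt_nbhsl.
apply: (near_eq_is_derive gE).
by rewrite -[h x]addr0; apply: is_deriveD.
Unshelve. all: by end_near. Qed.

(* Equals [f' x] wherever [f] is derivable, but is defined everywhere, which
   makes its level sets Borel for continuous [f]. *)
Definition upper_slope f x : \bar R :=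
  limn_esup (fun n => (n.+1%:R * (f (x + n.+1%:R^-1) - f x))%:E).

Lemma measurable_upper_slope f : continuous f ->
  measurable_fun setT (upper_slope f).
Proof.
move=> cf; rewrite /upper_slope; apply: measurable_fun_limn_esup => n.
apply/measurable_EFinP; apply: continuous_measurable_fun => x.
apply: cvgMl_tmp; apply: cvgB; last exact: cf.
apply: (@cvg_comp _ _ _ (fun y => y + n.+1%:R^-1) f); last exact: cf.
by apply: cvgD; [exact: cvg_id|exact: cvg_cst].
Qed.

Lemma measurable_upper_slope_eq f (r : R) : continuous f ->
  measurable [set x | upper_slope f x = r%:E].
Proof.
move=> cf; rewrite -[X in measurable X]setTI.
exact: (measurable_upper_slope cf measurableT (emeasurable_set1 r%:E)).
Qed.

Lemma is_derive_upper_slope f x df : is_derive x 1 f df ->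
  upper_slope f x = df%:E.
Proof.
move=> dfx; apply: (cvg_limn_einf_sup _).2.
apply/fine_cvgP; split; first exact: nearW.
apply/cvgrPdist_le => e e0; have [d d0 hd] := is_derive_slope dfx e0.
near=> n => /=.
have n0 : 0 < n.+1%:R^-1 :> R by rewrite invr_gt0.
have := hd (x + n.+1%:R^-1); rewrite addrAC subrr add0r invrK mulrC.
apply; first by rewrite -subr_eq0 addrAC subrr add0r gt_eqF.
by rewrite gtr0_norm//; near: n; exact: near_infty_natSinv_lt (PosNum d0).
Unshelve. all: by end_near. Qed.

Lemma increment_upper_slope f :
    (forall x y, `|f x - f y| <= `|x - y|) ->
    (forall x, Lip f x = 0%E \/ Lip f x = 1%E) ->
  forall c d, c <= d -> f d - f c =
    fine (lambda ([set x | upper_slope f x = 1%E] `&` `]c, d]))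
    - fine (lambda ([set x | upper_slope f x = (-1)%:E] `&` `]c, d])).
Proof.
move=> lf f01 c d cd.
set P := [set x | _ = 1%E]; set N := [set x | _ = (-1)%:E].
have cf := lipschitz_continuous lf.
have mP : measurable P by exact: measurable_upper_slope_eq.
have mN : measurable N by exact: measurable_upper_slope_eq.
(* As [f] is 1-Lipschitz, both [g] and [x - g x = (x - f x) / 2] are nondecreasing. *)
pose g x := (x + f x) / 2.
have ndg : nondecreasing g.
  move=> x y xy; rewrite /g ler_pM2r//.
  by have := ler_normlW (lf x y); rewrite [`|x - y|]ler0_norm ?subr_le0//; lra.
have ndg' : nondecreasing (fun x => x - g x).
  move=> x y xy; rewrite /g.
  by have := ler_normlW (lf y x); rewrite ger0_norm ?subr_ge0//; lra.
(* The margin of 1 puts the endpoint [d] inside the open interval on which differentiability is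
   known. *)
have ab : c - 1 < d + 1 by lra.
have [h [ih hE aeh]] := monotone_ae_derive ab ndg ndg'.
(* Here [f' = 2 h - 1] is 0, 1 or -1, so [h] is half of [1 + 1_P - 1_N]. The constant is written as
   an indicator so that [i1] and [int1] cover all three terms. *)
have hPN : {ae lambda, forall x, `]c, d]%classic x ->
    (h x)%:E = (2^-1 * (\1_setT x + \1_P x - \1_N x))%:E}.
  move: aeh; apply: filterS; first exact: (ae_filter_ringOfSetsType lambda).
  move=> x hx; rewrite /= in_itv/= => /andP[cx xd].
  have {}hx : is_derive x 1 g (h x) by apply: hx; lra.
  have dfx : is_derive x 1 f (2 * h x - 1).
    have -> : f = (fun y => 2 *: g y - y).
      by apply/funext => y; rewrite /g /GRing.scale/=; lra.
    by apply: is_deriveB.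
  have := f01 x; rewrite (is_derive_Lip dfx) => f01x.
  have usE := is_derive_upper_slope dfx.
  have PE : \1_P x = (2 * h x - 1 == 1)%:R :> R.
    rewrite indicE; congr (nat_of_bool _)%:R; apply/idP/eqP.
      by rewrite inE /P/= usE => -[].
    by rewrite inE /P/= usE => ->.
  have NE : \1_N x = (2 * h x - 1 == -1)%:R :> R.
    rewrite indicE; congr (nat_of_bool _)%:R; apply/idP/eqP.
      by rewrite inE /N/= usE => -[].
    by rewrite inE /N/= usE => ->.
  congr (_%:E); rewrite PE NE indicT /=.
  case: f01x => -[].
    move=> /eqP; rewrite normr_eq0 => /eqP h0.
    rewrite h0 lt_eqF ?ltr01// gt_eqF ?ltrN10// /=; lra.
  move=> /eqP; rewrite eqr_norml ler01 andbT => /orP[]/eqP h1; rewrite h1.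
    by rewrite eqxx (_ : (1 == -1 :> R) = false) ?gt_eqF//=; lra.
  by rewrite eqxx (_ : (-1 == 1 :> R) = false) ?lt_eqF//=; lra.
have mcd : measurable (`]c, d]%classic : set (measurableTypeR R)).
  exact: measurable_itv.
have cdE : lambda `]c, d]%classic = (d - c)%:E.
  exact: (lebesgue_stieltjes_measure_ocitv idfun cd).
have i1 A : measurable A -> lambda.-integrable `]c, d] (EFin \o \1_A).
  move=> mA; apply/integrableP; split; first exact/measurable_EFinP/measurable_indic.
  under eq_integral do rewrite /= ger0_norm//.
  rewrite integral_indic//; apply: (@le_lt_trans _ _ (lambda `]c, d]%classic)).
    by apply: le_measure; rewrite ?inE//; exact: measurableI.
  by rewrite cdE ltry.
have int1 A : measurable A ->
    \int[lambda]_(x in `]c, d]) \1_A x = fine (lambda (A `&` `]c, d])).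
  by move=> mA; rewrite /Rintegral integral_indic.
have : \int[lambda]_(x in `]c, d]) h x = g d - g c by apply: hE; lra.
have -> : \int[lambda]_(x in `]c, d]) h x =
    \int[lambda]_(x in `]c, d]) (2^-1 * (\1_setT x + \1_P x - \1_N x)).
  congr fine; apply: ae_eq_integral => //.
  - by apply: measurable_funTS; exact: (measurable_int lambda).
  - apply/measurable_EFinP; apply: measurable_funM => //.
    by apply: measurable_funB; [apply: measurable_funD|];
      exact: measurable_indic.
have iTP : lambda.-integrable `]c, d] (EFin \o (fun x => \1_setT x + \1_P x)).
  exact: (integrableD mcd (i1 _ measurableT) (i1 _ mP)).
have iTPN : lambda.-integrable `]c, d]
    (EFin \o (fun x => \1_setT x + \1_P x - \1_N x)).
  exact: (integrableB mcd iTP (i1 _ mN)).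
rewrite RintegralZl//= RintegralB//; last exact: i1.
rewrite RintegralD//; [|exact: i1|exact: i1].
rewrite !int1//.
rewrite setTI cdE/= /g; lra.
Qed.

End density.

(** * Completed Lebesgue measure of traces on bounded intervals *)

Section meas.
Context {R : realType}.
Implicit Types (A B : set R) (a b c : R).
Local Notation mu := (@completed_lebesgue_measure R).

Lemma lebesgue_measurable_borel A : measurable A -> lebesgue_measurable A.
Proof. exact: sub_caratheodory. Qed.

Lemma lebesgue_measurable_itv (i : interval R) : lebesgue_measurable [set` i].
Proof. by apply: lebesgue_measurable_borel; exact: measurable_itv. Qed.

Lemma lebesgue_measurableI_itv A (i : interval R) :
  lebesgue_measurable A -> lebesgue_measurable (A `&` [set` i]).
Proof.
move=> mA; apply: caratheodory_measurable_setI => //.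
exact: lebesgue_measurable_itv.
Qed.

Lemma mu_itv a b (x y : bool) : a <= b ->
  mu [set` Interval (BSide x a) (BSide y b)] = (b - a)%:E.
Proof.
move=> ab.
transitivity (lebesgue_measure [set` Interval (BSide x a) (BSide y b)]) => //.
rewrite lebesgue_measure_itv/= lte_fin lt_neqAle ab andbT.
by have [->|] := eqVneq a b; rewrite ?subrr//= EFinB.
Qed.

Lemma meas_itv a b (x y : bool) : a <= b ->
  meas [set` Interval (BSide x a) (BSide y b)] = b - a.
Proof. by move=> ab; rewrite /meas mu_itv. Qed.

Lemma meas_ge0 A : 0 <= meas A.
Proof. by rewrite fine_ge0. Qed.

(** Finiteness is what makes [fine], hence [meas], additive on traces. *)
Lemma mu_setI_itv_fin A (a b : R) (x y : bool) : lebesgue_measurable A ->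
  mu (A `&` [set` Interval (BSide x a) (BSide y b)]) \is a fin_num.
Proof.
move=> mA; rewrite ge0_fin_numE//.
have [ab|ba] := leP a b; last first.
  by rewrite set_itv_ge ?setI0 ?measure0// ?bnd_simp -?leNgt; case: x y => -[];
    rewrite bnd_simp -?leNgt// ltW.
apply: (@le_lt_trans _ _ (mu [set` Interval (BSide x a) (BSide y b)])).
  by apply: le_outer_measure; exact: subIsetr.
by rewrite mu_itv// ltry.
Qed.

Lemma completed_measureU A B : lebesgue_measurable A -> lebesgue_measurable B ->
  A `&` B = set0 -> mu (A `|` B) = (mu A + mu B)%E.
Proof. by move=> mA mB AB; apply: measureU. Qed.

Lemma meas_setU A B a b : lebesgue_measurable A -> lebesgue_measurable B ->
    A `&` B = set0 ->
  meas ((A `|` B) `&` `[a, b]) = meas (A `&` `[a, b]) + meas (B `&` `[a, b]).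
Proof.
move=> mA mB AB0; rewrite /meas setIUl.
rewrite completed_measureU.
- by rewrite fineD//; exact: mu_setI_itv_fin.
- exact: lebesgue_measurableI_itv.
- exact: lebesgue_measurableI_itv.
- by rewrite setIACA AB0 set0I.
Qed.

Lemma meas_le_itv A a b : a <= b -> lebesgue_measurable A ->
  meas (A `&` `[a, b]) <= b - a.
Proof.
move=> ab mA; rewrite -lee_fin -(mu_itv true false ab) fineK ?mu_setI_itv_fin//.
by apply: le_outer_measure; exact: subIsetr.
Qed.

Lemma meas_chasles A (x y z : bool) a c b : lebesgue_measurable A ->
    (BSide x a <= BSide y c)%O -> (BSide y c <= BSide z b)%O ->
  meas (A `&` [set` Interval (BSide x a) (BSide z b)]) =
  meas (A `&` [set` Interval (BSide x a) (BSide y c)]) +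
  meas (A `&` [set` Interval (BSide y c) (BSide z b)]).
Proof.
move=> mA ac cb; rewrite (itv_bndbnd_setU ac cb) setIUr.
rewrite /meas completed_measureU.
- by rewrite fineD//; exact: mu_setI_itv_fin.
- exact: lebesgue_measurableI_itv.
- exact: lebesgue_measurableI_itv.
rewrite setIACA setIid; apply/seteqP; split => // t [_] [].
rewrite /= !itv_boundlr => /andP[_ ty] /andP[yt _].
by have := le_trans ty yt; rewrite bnd_simp ltxx.
Qed.

(** Links the half-open intervals of Stieltjes measures to the closed ones of the decomposition: the
    part split off is [[a, a]], of measure at most [a - a]. *)
Lemma meas_itvcc A a b : lebesgue_measurable A -> a <= b ->
  meas (A `&` `[a, b]) = meas (A `&` `]a, b]).
Proof.
move=> mA ab; rewrite (@meas_chasles A true false false a a b) ?bnd_simp//.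
rewrite [X in X + _](_ : _ = 0) ?add0r//.
apply/le_anti/andP; split; last exact: meas_ge0.
by rewrite (le_trans (meas_le_itv (lexx a) mA))// subrr.
Qed.

End meas.

(** * Slopes and densities over small intervals containing a point *)

Section intervals.
Context {R : realType}.
Implicit Types (f : R -> R) (S : set R) (a b x : R).

(** If all slopes from [x] to nearby points were at most [1 - e], adding the two parts of an
    interval around [x] would bound its slope by [1 - e]. An interval with slope at least
    [1 - e / 2] contradicts this. *)
Lemma Lip_ge1_itvP f x : (1 <= Lip f x)%E <->
  forall e, 0 < e -> exists a b,
    [/\ a <= x <= b, a < b, b - a < e & (1 - e) * (b - a) <= `|f b - f a|].
Proof.
split=> [/Lip_geP h e /h[y [yx yxe hy]]|h].
  have [xy|xy] := ltP x y.
    exists x, y; rewrite lexx ltW//.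
    by move: yxe hy; rewrite gtr0_norm ?subr_gt0//; split.
  have {}yx : y < x by rewrite lt_neqAle yx.
  exists y, x; rewrite lexx ltW//.
  by move: yxe hy; rewrite distrC gtr0_norm ?subr_gt0// [leRHS]distrC; split.
apply/Lip_geP => e e0; apply: contrapT => noy.
have slow y : `|y - x| < e -> `|f y - f x| <= (1 - e) * `|y - x|.
  move=> yx; rewrite leNgt; apply/negP => hy; apply: noy; exists y; split=> //.
    by apply/eqP => yxE; move: hy; rewrite yxE !subrr normr0 mulr0 ltxx.
  exact: ltW.
have e20 : 0 < e / 2 by rewrite divr_gt0.
have [a [b [/andP[ax xb] ab abe hab]]] := h _ e20.
have fb := slow b; rewrite ger0_norm ?subr_ge0// in fb.
have fa := slow a; rewrite distrC ger0_norm ?subr_ge0// in fa.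
have := ler_distD (f x) (f b) (f a); rewrite [`|f x - f a|]distrC.
have {}fa := fa ltac:(lra); have {}fb := fb ltac:(lra).
have : 0 < e / 2 * (b - a) by rewrite mulr_gt0 ?subr_gt0.
lra.
Qed.

Lemma shrinks_toP (I : nat -> set R) x : shrinks_to I x ->
  exists a b : nat -> R,
  [/\ forall n, a n < b n, forall n, a n <= x <= b n,
      forall n, I n = `[a n, b n]%classic &
      forall e, 0 < e -> \forall n \near \oo, b n - a n < e].
Proof.
move=> [/choice[a /choice[b abI]] Ix I0].
have ab n : a n < b n := (abI n).1.
have IE n : I n = `[a n, b n]%classic := (abI n).2.
exists a, b; split=> // [n|e e0].
  by have := Ix n; rewrite IE /= in_itv.
have /cvgrPdist_lt/(_ _ e0) := I0; apply: filterS => n.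
by rewrite sub0r normrN IE meas_itv ?(ltW (ab n))// gtr0_norm ?subr_gt0.
Qed.

Lemma shrinks_to_itv (a b : nat -> R) x :
    (forall n, a n < b n) -> (forall n, a n <= x <= b n) ->
    (forall n, b n - a n < n.+1%:R^-1) ->
  shrinks_to (fun n => `[a n, b n]%classic) x.
Proof.
move=> ab axb ab0; split=> [n|n|].
- by exists (a n), (b n).
- by rewrite /= in_itv/=; exact: axb.
apply/cvgrPdist_lt => e e0; near=> n.
rewrite sub0r normrN meas_itv ?(ltW (ab n))// gtr0_norm ?subr_gt0//.
by apply: (lt_trans (ab0 n)); near: n; exact: near_infty_natSinv_lt (PosNum e0).
Unshelve. all: by end_near. Qed.

(** The density ratio never exceeds 1, so convergence to 1 amounts to lower bounds. One [e] bounds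
    both length and defect, and the values [1 / (n + 1)] rebuild the sequence. *)
Lemma weakly_dense_atP S x : lebesgue_measurable S -> weakly_dense_at S x <->
  forall e, 0 < e -> exists a b, [/\ a <= x <= b, a < b, b - a < e &
    (1 - e) * (b - a) <= meas (S `&` `[a, b])].
Proof.
move=> mS; split=> [[I [/shrinks_toP[a [b [ab axb IE ab0]]]]] + e e0|h].
  move=> /cvgrPdist_le/(_ _ e0) SI; near \oo => n.
  exists (a n), (b n); split=> //; first by near: n; exact: ab0.
  have : `|1 - meas (S `&` I n) / meas (I n)| <= e by near: n.
  move=> /ler_normlW; rewrite IE meas_itv ?(ltW (ab n))// => hS.
  by rewrite -ler_pdivlMr ?subr_gt0//; lra.
have n0 n : 0 < n.+1%:R^-1 :> R by rewrite invr_gt0.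
have /choice[a /choice[b abP]] := fun n => h _ (n0 n).
exists (fun n => `[a n, b n]%classic); split.
  by apply: shrinks_to_itv => n; have [] := abP n.
apply/cvgrPdist_le => e e0; near=> n.
have [_ ab _ Sab] := abP n.
rewrite meas_itv ?(ltW ab)//.
have : n.+1%:R^-1 < e by near: n; exact: near_infty_natSinv_lt (PosNum e0).
rewrite -ler_pdivlMr ?subr_gt0// in Sab.
have : meas (S `&` `[a n, b n]) / (b n - a n) <= 1.
  by rewrite ler_pdivrMr ?subr_gt0// mul1r meas_le_itv// ltW.
move=> S1 ne; rewrite ger0_norm ?subr_ge0//.
by rewrite lerBlDr -lerBlDl (le_trans _ Sab)// lerD2l lerN2 ltW.
Unshelve. all: by end_near. Qed.

(** * Functions whose increments are differences of the measures of two disjoint sets *)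

Section increment.
Context (f : R -> R) (P N : set R).
Hypotheses (mP : lebesgue_measurable P) (mN : lebesgue_measurable N).
Hypothesis PN0 : P `&` N = set0.
Hypothesis incE : forall a b, a <= b ->
  f b - f a = meas (P `&` `[a, b]) - meas (N `&` `[a, b]).

Let measPN_le a b : a <= b ->
  meas (P `&` `[a, b]) + meas (N `&` `[a, b]) <= b - a.
Proof.
move=> ab; rewrite -meas_setU//.
by apply: meas_le_itv => //; exact: caratheodory_measurable_setU.
Qed.

Lemma increment_lipschitz x y : `|f x - f y| <= `|x - y|.
Proof.
wlog xy : x y / x <= y.
  by move=> H; have [/H//|/ltW/H] := leP x y; rewrite distrC (distrC x).
rewrite distrC (distrC x) [leRHS]ger0_norm ?subr_ge0// incE//.
have := measPN_le xy; have := meas_ge0 (P `&` `[x, y]).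
by have := meas_ge0 (N `&` `[x, y]); rewrite ler_norml; lra.
Qed.

Lemma increment_Lip_le1 x : (Lip f x <= 1)%E.
Proof.
apply/Lip_leP => e e0; exists 1 => // y _.
apply: (le_trans (increment_lipschitz _ _)).
by rewrite ler_peMl//; lra.
Qed.

Lemma increment_Lip_ge1 x :
  (1 <= Lip f x)%E <-> weakly_dense_at P x \/ weakly_dense_at N x.
Proof.
rewrite Lip_ge1_itvP; split=> [h|dense e e0].
  (* The sign of the increment may vary with the interval, so neither set can be chosen in advance.
     Arguing by contradiction, each set has its own failing threshold, and one interval good for the
     smaller threshold refutes one of them. *)
  apply: contrapT => /not_orP[nP nN].
  move: nP => /(weakly_dense_atP _ mP)/existsNP[e1 /not_implyP[e10 nP]].
  move: nN => /(weakly_dense_atP _ mN)/existsNP[e2 /not_implyP[e20 nN]].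
  have e0 : 0 < Order.min e1 e2 by rewrite lt_min e10.
  have e12 : Order.min e1 e2 <= e1 by rewrite ge_min lexx.
  have e21 : Order.min e1 e2 <= e2 by rewrite ge_min lexx orbT.
  have [a [b [axb ab abe]]] := h _ e0.
  rewrite incE ?(ltW ab)// => hab.
  have weaken e : Order.min e1 e2 <= e ->
      (1 - e) * (b - a) <= (1 - Order.min e1 e2) * (b - a).
    by move=> ?; rewrite ler_pM2r ?subr_gt0// lerD2l lerN2.
  have w1 := weaken _ e12; have w2 := weaken _ e21.
  have P0 := meas_ge0 (P `&` `[a, b]); have N0 := meas_ge0 (N `&` `[a, b]).
  have : (1 - e1) * (b - a) <= meas (P `&` `[a, b]) \/
         (1 - e2) * (b - a) <= meas (N `&` `[a, b]).
    by move: hab; rewrite ler_normr => /orP[]; [left|right]; lra.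
  case=> [hP|hN]; [apply: nP|apply: nN]; exists a, b; split=> //; lra.
have e20 : 0 < e / 2 by rewrite divr_gt0.
have [S [mS S_or dS]] : exists S, [/\ lebesgue_measurable S, S = P \/ S = N &
    weakly_dense_at S x].
  by case: dense => [dP|dN]; [exists P|exists N]; split=> //; [left|right].
have [a [b [axb ab abe hS]]] := (weakly_dense_atP x mS).1 dS _ e20.
exists a, b; split=> //; first lra.
rewrite incE ?(ltW ab)//; have := measPN_le (ltW ab).
(* If [S] misses at most the fraction [e / 2], the other set has at most that fraction, so the
   difference is at least [1 - e] of the length. *)
have -> : (1 - e) * (b - a) = 2 * ((1 - e / 2) * (b - a)) - (b - a) by field.
by rewrite ler_normr; case: S_or hS => -> hS ?; apply/orP; [left|right]; lra.
Qed.

Lemma increment_Lip_le0 x : (Lip f x <= 0)%E <->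
  forall I : nat -> set R, shrinks_to I x ->
    `|meas (P `&` I n) - meas (N `&` I n)| / meas (I n) @[n --> \oo] --> (0 : R).
Proof.
rewrite Lip_leP; split=> [h I /shrinks_toP[a [b [ab axb IE ab0]]]|h e e0].
  apply/cvgrPdist_le => e e0; have [d d0 hd] := h e e0; near=> n.
  have abd : b n - a n < d by near: n; exact: ab0.
  have {axb}/andP[ax xb] := axb n; have {}ab := ab n.
  rewrite sub0r normrN IE meas_itv ?(ltW ab)// -incE ?(ltW ab)//.
  rewrite normrM normr_id normfV [`|b n - a n|]gtr0_norm ?subr_gt0//.
  rewrite ler_pdivrMr ?subr_gt0//.
  have fb := hd (b n); rewrite ger0_norm ?subr_ge0// in fb.
  have fa := hd (a n); rewrite distrC ger0_norm ?subr_ge0// in fa.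
  have := ler_distD (f x) (f (b n)) (f (a n)).
  rewrite [`|f x - f (a n)|]distrC.
  have {}fa := fa ltac:(lra); have {}fb := fb ltac:(lra); lra.
(* If no radius works for [e], there are points [y] within [1 / (n + 1)] of [x] with slope above
   [e]; the intervals between [x] and these points shrink to [x] and violate the limit. *)
apply: contrapT => nod.
have fast n : exists y, `|y - x| < n.+1%:R^-1 /\ e * `|y - x| < `|f y - f x|.
  apply: contrapT => noy; apply: nod; exists n.+1%:R^-1; first by rewrite invr_gt0.
  move=> y yx; rewrite add0r leNgt; apply/negP => ?.
  by apply: noy; exists y.
have fast_itv n : exists ab : R * R, [/\ ab.1 < ab.2, ab.1 <= x <= ab.2,
    ab.2 - ab.1 < n.+1%:R^-1 & e * (ab.2 - ab.1) < `|f ab.2 - f ab.1|].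
  have [y [yx hy]] := fast n; have [xy|xy|xy] := ltgtP x y.
  - exists (x, y) => /=; rewrite lexx ltW//.
    by move: yx hy; rewrite gtr0_norm ?subr_gt0//; split.
  - exists (y, x) => /=; rewrite lexx ltW// [`|f x - f y|]distrC.
    by move: yx hy; rewrite [`|y - x|]distrC gtr0_norm ?subr_gt0//; split.
  - by move: hy; rewrite xy !subrr normr0 mulr0 ltxx.
have [ab abP] := choice fast_itv.
have /h/cvgrPdist_le/(_ _ e0) :
    shrinks_to (fun n => `[(ab n).1, (ab n).2]%classic) x.
  by apply: shrinks_to_itv => n; have [] := abP n.
move=> [n _ /(_ n (leqnn n))]; have [abn _ _ hab] := abP n.
rewrite sub0r normrN meas_itv ?(ltW abn)// -incE ?(ltW abn)//.
rewrite normrM normr_id normfV [X in _ / X]gtr0_norm ?subr_gt0//.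
by rewrite ler_pdivrMr ?subr_gt0// leNgt hab.
Unshelve. all: by end_near. Qed.

End increment.
End intervals.

(** * Primitives of indicator functions *)

Section primitive.
Context {R : realType}.
Implicit Types (A : set R) (a b x : R).

(** The signed integral of [1_A] from 0 to [x]: at least one of the two intervals is empty,
    according to the sign of [x]. *)
Definition meas_primitive A x : R :=
  meas (A `&` `]0, x]) - meas (A `&` `]x, 0]).

Lemma meas_primitiveB A a b : lebesgue_measurable A -> a <= b ->
  meas_primitive A b - meas_primitive A a = meas (A `&` `[a, b]).
Proof.
move=> mA ab; rewrite meas_itvcc// /meas_primitive.
have empty c d : d <= c -> meas (A `&` `]c, d]) = 0.
  by move=> dc; rewrite set_itv_ge ?setI0 ?bnd_simp -?leNgt// /meas measure0.
have chasles c d e : c <= d -> d <= e ->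
    meas (A `&` `]c, e]) = meas (A `&` `]c, d]) + meas (A `&` `]d, e]).
  by move=> cd de; exact: meas_chasles.
have [a0|/ltW a0] := leP 0 a.
  have b0 : 0 <= b := le_trans a0 ab.
  by rewrite (empty a 0)// (empty b 0)// (chasles 0 a b)//; lra.
have [b0|/ltW b0] := leP 0 b.
  by rewrite (empty b 0)// (empty 0 a)// (chasles a 0 b)//; lra.
by rewrite (empty 0 a)// (empty 0 b)// (chasles a b 0)//; lra.
Qed.

End primitive.

(** * Borel measurability of the set *)

Lemma Lip1_measurable (R : realType) (f : R -> R) (E : set R) :
    continuous f -> (forall x, Lip f x = (\1_E x)%:E) -> measurable E.
Proof.
move=> cf LipE.
(* [Lip f] only takes the values 0 and 1: any threshold in between detects [E]. *)
pose U (h : R) := [set x | `|h| / 2 < `|f (x + h) - f x|].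
pose H k := [set h : R | 0 < `|h| < k.+1%:R^-1].
have oU h : open (U h).
  have -> : U h =
      (fun x => `|f (x + h) - f x|) @^-1` [set y | `|h| / 2 < y] by [].
  apply: open_comp; last exact: open_gt.
  move=> x _; apply: cvg_norm; apply: cvgB; last exact: cf.
  apply: (@cvg_comp _ _ _ (fun y => y + h) f); last exact: cf.
  by apply: cvgD; [exact: cvg_id|exact: cvg_cst].
(* Slopes above 1/2 occur at arbitrarily small steps exactly on [E], which is therefore a countable
   intersection of open sets. *)
have -> : E = \bigcap_k \bigcup_(h in H k) U h.
  apply/seteqP; split=> x.
    move=> Ex k _; have := LipE x; rewrite indicE mem_set// => /eqP.
    rewrite eq_le => /andP[_] /Lip_geP.
    (* The first entry puts the step in [H k]; the second keeps the slope at least 3/4, above the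
       threshold 1/2. *)
    have e0 : 0 < Order.min k.+1%:R^-1 4^-1 :> R by rewrite lt_min !invr_gt0 !ltr0n.
    move=> /(_ _ e0)[y [yx]]; rewrite lt_min => /andP[yk y4] hy.
    have yx0 : 0 < `|y - x| by rewrite normr_gt0 subr_eq0.
    exists (y - x); rewrite /H/U/=; first by rewrite yx0.
    rewrite (addrC x) subrK; apply: lt_le_trans hy; rewrite mulrC ltr_pM2r//.
    have : Order.min k.+1%:R^-1 4^-1 <= 4^-1 :> R by rewrite ge_min lexx orbT.
    rewrite /=; lra.
  move=> xU; apply: contrapT => nEx.
  have : (Lip f x <= 0)%E by rewrite LipE indicE memNset.
  have e0 : 0 < 2^-1 :> R by rewrite invr_gt0.
  move=> /Lip_leP/(_ _ e0)[d d0 hd].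
  have [k _ /(_ k (leqnn k)) kd] := near_infty_natSinv_lt (PosNum d0).
  have [h /andP[h0 hk]] := xU k Logic.I.
  rewrite /U/= ltNge => /negP; apply.
  have := hd (x + h); rewrite addrAC subrr add0r => /(_ (lt_trans hk kd)).
  by rewrite add0r mulrC.
apply: bigcapT_measurable => k; apply: open_measurable.
by apply: bigcup_open => h _; exact: oU.
Qed.

(** * The equivalence *)

Theorem theorem4p3 (R : realType) (E : set R) :
  Lip1 E <-> exists E1 E0 En1 : set R, ternary_decomposition E E1 E0 En1.
Proof.
split=> [[f [cf LipE]]|
  [E1 [E0 [En1 [mE m1 m0 mN d10 d1N d0N cover in_E notin_E]]]]].
  have f01 x : Lip f x = 0%E \/ Lip f x = 1%E.
    by rewrite LipE indicE; case: (x \in E); [right|left].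
  have lf : forall x y, `|f x - f y| <= `|x - y|.
    apply: Lip_le1_lipschitz => // x.
    by case: (f01 x) => ->; rewrite ?lexx ?lee01.
  pose D r := [set x | upper_slope f x = r%:E].
  have mD r : lebesgue_measurable (D r).
    by apply: lebesgue_measurable_borel; exact: measurable_upper_slope_eq.
  have DN0 : D 1 `&` D (-1) = set0.
    apply/seteqP; split=> // x [] /=; rewrite /D/= => -> [].
    by move=> /eqP; rewrite gt_eqF//; lra.
  have incE a b : a <= b ->
      f b - f a = meas (D 1 `&` `[a, b]) - meas (D (-1) `&` `[a, b]).
    by move=> ab; rewrite !meas_itvcc// (increment_upper_slope lf f01 ab).
  (* The middle set is a complement rather than [D 0], because without a derivative the upper slope
     need not be -1, 0 or 1. *)
  exists (D 1), (~` (D 1 `|` D (-1))), (D (-1)); split=> //.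
  - exact: (lebesgue_measurable_borel (Lip1_measurable cf LipE)).
  - apply/caratheodory_measurable_setC.
    by apply: caratheodory_measurable_setU; exact: mD.
  - by rewrite setCU setIA setICr set0I.
  - by rewrite setCU -setIA [~` D (-1) `&` _]setIC setICr setI0.
  - by rewrite setUAC setUCr.
  - move=> x Ex; apply/(increment_Lip_ge1 (mD 1) (mD (-1)) DN0 incE).
    by rewrite LipE indicE mem_set.
  - move=> x nEx; apply/(increment_Lip_le0 incE).
    by rewrite LipE indicE memNset.
(* A primitive of [1_E1 - 1_En1], with exactly the increments required above. *)
pose f x := meas_primitive E1 x - meas_primitive En1 x.
have incE a b : a <= b ->
    f b - f a = meas (E1 `&` `[a, b]) - meas (En1 `&` `[a, b]).
  by move=> ab; rewrite -!meas_primitiveB// /f; ring.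
exists f; split.
  exact/lipschitz_continuous/(increment_lipschitz m1 mN d1N incE).
move=> x; apply/eqP; rewrite eq_le indicE; have [Ex|nEx] := pselect (E x).
  rewrite mem_set// (increment_Lip_le1 m1 mN d1N incE)/=.
  exact/(increment_Lip_ge1 m1 mN d1N incE)/in_E.
rewrite memNset// Lip_ge0 andbT.
exact/(increment_Lip_le0 incE)/notin_E.
Qed.
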